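(* There is an $8\,CCS\to1\,CCS$ distillation protocol at distance $2$: let $G\in\mathbb F_8^{2\times8}$ be $$\begin{pmatrix}0&\alpha&\alpha^2&\alpha^3&\alpha^4&\alpha^5&\alpha^6&1\\\hline1&1&1&1&1&1&1&1\end{pmatrix}$$ with one logical row and one stabilizer row. Then the $Z$-distance of the corresponding CSS code is $2$, and applying $CCS$ to the three qubits of each of the eight physical $\mathbb F_8$-qudits implements on the three logical qubits (and trivially with respect to the stabilizer row) the gate $$CCS_{123}\,CS^\dagger_{12}\,CS^\dagger_{13}\,CS^\dagger_{23}\,S_1S_2S_3 ,$$ which, up to a global phase, equals $(X_1X_2X_3)\,CCS_{123}^\dagger\,(X_1X_2X_3)$, i.e. is Pauli equivalent to $CCS^\dagger_{123}$. That is, with $D_G$ as in the context, $D_G=W\otimes I$, where $W$ is the displayed gate on the logical qudit.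
   Context: $\mathbb F_8=\mathbb F_2(\alpha)$, $\alpha^3=\alpha+1$, with the self-dual normal basis $\alpha_0=\alpha^2+\alpha+1$, $\alpha_1=\alpha+1$, $\alpha_2=\alpha^2+1$ over $\mathbb F_2$. Writing $\gamma=b_0\alpha_0+b_1\alpha_1+b_2\alpha_2$ identifies an $\mathbb F_8$-qudit with three qubits. $S=\mathrm{diag}(1,i)$; $CS$ multiplies $|b_0b_1\rangle$ by $i^{b_0b_1}$; $CCS$ multiplies $|b_0b_1b_2\rangle$ by $i^{b_0b_1b_2}$. Put $c(\gamma)=b_0b_1b_2\in\{0,1\}$. A full-rank matrix $G\in\mathbb F_8^{m\times n}$ with $k$ logical rows defines a CSS code on $n$ qudits: the first $k$ rows are $X$-logical operators and the others $X$-stabilizer generators. Its $Z$-distance is the minimum Hamming weight over $\mathbb F_8$ of a vector orthogonal (for $\sum x_iy_i$) to all stabilizer rows but not to at least one logical row. The unitary on $m$ qudits (one per row) induced by applying $CCS$ to each physical qudit is $D_G|u\rangle=i^{\sum_{i=1}^nc(\sum_au_ag_{a,i})}|u\rangle$, $u\in\mathbb F_8^m$ (inner sum in $\mathbb F_8$, outer sum over integers). *)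

(* Defs.v *)
From HB Require Import structures.
From mathcomp Require Import all_boot all_order all_fingroup all_algebra all_field.
From mathcomp Require Import sesquilinear spectral ring.

Set Implicit Arguments.
Unset Strict Implicit.
Unset Printing Implicit Defensive.

Import GRing.Theory Num.Theory.
Local Open Scope ring_scope.

(* Computational basis of three qubits. The qubits numbered 1, 2, 3 in gate
   subscripts are the indices 0, 1, 2, so that qubit j+1 carries b_j. *)
Definition bits := {ffun 'I_3 -> bool}.

Definition q1 : 'I_3 := @Ordinal 3 0 isT.
Definition q2 : 'I_3 := @Ordinal 3 1 isT.
Definition q3 : 'I_3 := @Ordinal 3 2 isT.

(* In the definitions below F is meant to be F_8 and alpha to satisfy
   alpha^3 = alpha + 1. *)

Definition nbasis (F : finFieldType) (alpha : F) (j : 'I_3) : F :=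
  nth 0 [:: alpha ^+ 2 + alpha + 1; alpha + 1; alpha ^+ 2 + 1] j.

Definition of_bits (F : finFieldType) (alpha : F) (b : bits) : F :=
  \sum_j (b j)%:R * nbasis alpha j.

(* The b with gamma = b_0 alpha_0 + b_1 alpha_1 + b_2 alpha_2. It exists and is
   unique (to_bitsK and of_bitsK below), so the default value is never used. *)
Definition to_bits (F : finFieldType) (alpha : F) (gamma : F) : bits :=
  odflt [ffun=> false] [pick b | of_bits alpha b == gamma].

Lemma of_bits_inj (F : finFieldType) (alpha : F) :
  #|F| = 8%N -> alpha ^+ 3 = alpha + 1 -> injective (of_bits alpha).
Proof.
move=> cardF alpha3.
have ch2 : 2 \in [pchar F] by apply: (@card_finPcharP F 2 3).
have xx (x : F) : x + x = 0 by rewrite addrr_pchar2.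
have two0 : (2%:R : F) = 0 by case/andP: ch2 => _ /eqP.
have a0 : alpha != 0.
  apply/eqP=> a0; move: alpha3; rewrite a0 expr0n add0r /= => /esym/eqP.
  by rewrite oner_eq0.
have aX k q x : x = 0 -> alpha ^+ k = x + 2%:R * q -> False.
  move=> -> /eqP; rewrite two0 mul0r add0r => /eqP; apply/eqP.
  by rewrite expf_neq0.
pose x (b b' : bits) : bits := [ffun j => b j (+) b' j].
have xE b b' : of_bits alpha (x b b') = of_bits alpha b + of_bits alpha b'.
  rewrite /of_bits -big_split; apply: eq_bigr => j _ /=.
  rewrite -mulrDl ffunE; congr (_ * _).
  by case: (b j); case: (b' j); rewrite ?addr0 ?add0r ?xx.
have z d : of_bits alpha d = 0 -> forall j, d j = false.
  have -> : of_bits alpha d = (d q1)%:R * (alpha ^+ 2 + alpha + 1)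
      + (d q2)%:R * (alpha + 1) + (d q3)%:R * (alpha ^+ 2 + 1).
    rewrite /of_bits !big_ord_recl big_ord0 addr0 addrA.
    by congr (_%:R * _ + _%:R * _ + _%:R * _); congr (d _); apply: val_inj.
  move=> h; suff [h1 h2 h3] : [/\ d q1 = false, d q2 = false & d q3 = false].
    by case=> [[|[|[|//]]] lt_j]; [rewrite -h1 | rewrite -h2 | rewrite -h3];
      congr (d _); apply: val_inj.
  move: h; case: (d q1); case: (d q2); case: (d q3) => //= h; exfalso.
  - by apply: (aX 0 (- (alpha ^+ 2 + alpha + 1)) _ h); ring.
  - by apply: (aX 2 (- (alpha + 1)) _ h); ring.
  - by apply: (aX 1 (- (alpha ^+ 2 + 1)) _ h); ring.
  - by apply: (aX 5 0 _ h); ring: alpha3.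
  - by apply: (aX 4 (- 1) _ h); ring: alpha3.
  - by apply: (aX 3 0 _ h); ring: alpha3.
  - by apply: (aX 6 alpha _ h); ring: alpha3.
move=> b b' ebb'; apply/ffunP => j.
have /z/(_ j) : of_bits alpha (x b b') = 0 by rewrite xE ebb' xx.
by rewrite ffunE; case: (b j); case: (b' j).
Qed.

Lemma of_bitsK (F : finFieldType) (alpha : F) :
  #|F| = 8%N -> alpha ^+ 3 = alpha + 1 ->
  cancel (of_bits alpha) (to_bits alpha).
Proof.
move=> cF a3 b; rewrite /to_bits; case: pickP => [b' /eqP|/(_ b)]; last first.
  by rewrite eqxx.
exact: of_bits_inj.
Qed.

Lemma to_bitsK (F : finFieldType) (alpha : F) :
  #|F| = 8%N -> alpha ^+ 3 = alpha + 1 ->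
  cancel (to_bits alpha) (of_bits alpha).
Proof.
move=> cF a3 g; have inj := of_bits_inj cF a3.
have : g \in codom (of_bits alpha).
  by rewrite inj_card_onto // cF card_ffun card_bool card_ord.
by case/codomP => b ->; rewrite of_bitsK.
Qed.

(* gamma |-> b_0 b_1 b_2, as a natural number *)
Definition cprod (F : finFieldType) (alpha gamma : F) : nat :=
  (\prod_(j < 3) to_bits alpha gamma j)%N.

(* CSS codes: G has k logical rows above r stabilizer rows. *)

Definition dotr (F : fieldType) n (x y : 'rV[F]_n) : F :=
  \sum_i x 0 i * y 0 i.

Definition hweight (F : fieldType) n (x : 'rV[F]_n) : nat :=
  #|[set i | x 0 i != 0]|.

Definition Zlogical (F : fieldType) k r n (G : 'M[F]_(k + r, n))
    (z : 'rV[F]_n) : Prop :=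
  (forall s : 'I_r, dotr (row s (dsubmx G)) z = 0) /\
  (exists l : 'I_k, dotr (row l (usubmx G)) z != 0).

Definition has_Zdistance (F : fieldType) k r n (G : 'M[F]_(k + r, n))
    (d : nat) : Prop :=
  (exists2 z, Zlogical G z & hweight z = d) /\
  (forall z, Zlogical G z -> (d <= hweight z)%N).

(* Operators between the Hilbert spaces with orthonormal bases |t>, t in a
   finite type, are matrices indexed by the enumerations of these types;
   opmx K has entries <s|opmx K|t> = K s t. *)

Notation op C T := 'M[C]_#|{: T}|.

Definition opmx (C : numClosedFieldType) (S T : finType) (K : S -> T -> C) :
    'M[C]_(#|S|, #|T|) :=
  \matrix_(i, j) K (enum_val i) (enum_val j).

Definition entry (C : numClosedFieldType) (S T : finType)
    (A : 'M[C]_(#|S|, #|T|)) (s : S) (t : T) : C :=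
  A (enum_rank s) (enum_rank t).

Definition diagop (C : numClosedFieldType) (T : finType) (f : T -> C) : op C T :=
  diag_mx (\row_i f (enum_val i)).

(* Transport of an operator along an identification f of basis labels. *)
Definition transport (C : numClosedFieldType) (S T : finType) (f : S -> T)
    (A : op C T) : op C S :=
  opmx (fun s s' : S => entry A (f s) (f s')).

(* Registers of n F-qudits have basis 'rV[F]_n. *)

Definition tensop (C : numClosedFieldType) (F : finFieldType) k r
    (A : op C 'rV[F]_k) (B : op C 'rV[F]_r) : op C 'rV[F]_(k + r) :=
  opmx (fun u v : 'rV[F]_(k + r) => entry A (lsubmx u) (lsubmx v)
                   * entry B (rsubmx u) (rsubmx v)).

Definition tensop_pow (C : numClosedFieldType) (F : finFieldType) n
    (A : op C F) : op C 'rV[F]_n :=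
  opmx (fun x y : 'rV[F]_n => \prod_(j < n) entry A (x 0 j) (y 0 j)).

(* |u> |-> |uG>; the code states are the images of |x>|+...+>, with the
   uniform superposition on the stabilizer rows. *)
Definition encoder (C : numClosedFieldType) (F : finFieldType) m n
    (G : 'M[F]_(m, n)) : 'M[C]_(#|{: 'rV[F]_n}|, #|{: 'rV[F]_m}|) :=
  opmx (fun (x : 'rV[F]_n) (u : 'rV[F]_m) => (x == u *m G)%:R).

(* Gates on three qubits; 'i is the imaginary unit of C. *)

Definition gateS (C : numClosedFieldType) (j : 'I_3) : op C bits :=
  diagop (fun b : bits => 'i ^+ b j).

Definition gateCS (C : numClosedFieldType) (j k : 'I_3) : op C bits :=
  diagop (fun b : bits => 'i ^+ (b j * b k)%N).

Definition gateCCS (C : numClosedFieldType) : op C bits :=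
  diagop (fun b : bits => 'i ^+ (b q1 * b q2 * b q3)%N).

Definition gateX (C : numClosedFieldType) (j : 'I_3) : op C bits :=
  opmx (fun b b' : bits => (b == [ffun l => b' l (+) (l == j)])%:R).

(* Operators on three qubits seen on one F_8-qudit, and on the register
   consisting of a single F_8-qudit. *)

Definition qudit_op (C : numClosedFieldType) (F : finFieldType) (alpha : F)
    (A : op C bits) : op C F :=
  transport (to_bits alpha) A.

Definition qudit_op1 (C : numClosedFieldType) (F : finFieldType) (alpha : F)
    (A : op C bits) : op C 'rV[F]_1 :=
  transport (fun v : 'rV[F]_1 => to_bits alpha (v 0 0)) A.

Definition induced_op (C : numClosedFieldType) (F : finFieldType) (alpha : F)
    m n (G : 'M[F]_(m, n)) : op C 'rV[F]_m :=
  diagop (fun u : 'rV[F]_m => 'i ^+ (\sum_(i < n) cprod alpha ((u *m G)%R 0%R i))%N).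

Definition distillG (F : finFieldType) (alpha : F) : 'M[F]_(1 + 1, 8) :=
  col_mx
    (\row_(i < 8) nth 0 [:: 0; alpha; alpha ^+ 2; alpha ^+ 3; alpha ^+ 4;
                            alpha ^+ 5; alpha ^+ 6; 1] i)
    (const_mx 1).

Local Open Scope sesquilinear_scope.

Definition gateW (C : numClosedFieldType) : op C bits :=
  gateCCS C *m (gateCS C q1 q2)^t* *m (gateCS C q1 q3)^t* *m (gateCS C q2 q3)^t*
  *m gateS C q1 *m gateS C q2 *m gateS C q3.

Definition gateXXX (C : numClosedFieldType) : op C bits :=
  gateX C q1 *m gateX C q2 *m gateX C q3.

(* Main.v *)
(* The entries of the logical row run over all of F_8.  Hence, for a logical
   label x <> 0 and any stabilizer label y, the eight symbols x g_i + y run over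
   F_8 as well, and exactly one of them has b_0 b_1 b_2 = 1; for x = 0 the phase
   is an eighth, hence trivial, power of a fourth root of unity.  So D_G is the
   phase i on all labels x <> 0, which is also W, because
   s_1 - s_2 + s_3 = 1 - (1 - b_0)(1 - b_1)(1 - b_2) for the elementary symmetric
   functions s_j of the bits.  The same identity exhibits W as i times the conjugate
   of CCS^dagger by the bit flip of all three qubits. *)
Require Import Defs.
From mathcomp Require Import all_boot all_order all_fingroup all_algebra all_field.
From mathcomp Require Import sesquilinear spectral ring.

Set Implicit Arguments.
Unset Strict Implicit.
Unset Printing Implicit Defensive.

Import GRing.Theory Num.Theory.
Local Open Scope ring_scope.
Local Open Scope sesquilinear_scope.

(** * Calculus of diagonal, relabelling and tensor operators in the labelled basis *)

Section Operators.

Variable C : numClosedFieldType.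

Lemma eq_opmx (S T : finType) (K L : S -> T -> C) : K =2 L -> opmx K = opmx L.
Proof. by move=> eqKL; apply/matrixP => i j; rewrite !mxE eqKL. Qed.

Lemma eq_diagop (T : finType) (f g : T -> C) : f =1 g -> diagop f = diagop g.
Proof. by move=> eqfg; congr diag_mx; apply/rowP => i; rewrite !mxE eqfg. Qed.

Lemma entry_opmx (S T : finType) (K : S -> T -> C) s t : entry (opmx K) s t = K s t.
Proof. by rewrite /entry mxE !enum_rankK. Qed.

Lemma entry_diagop (T : finType) (f : T -> C) s t :
  entry (diagop f) s t = f s *+ (s == t).
Proof. by rewrite /entry !mxE enum_rankK (inj_eq enum_rank_inj). Qed.

Lemma entry1 (T : finType) (s t : T) : entry (1%:M : op C T) s t = (s == t)%:R.
Proof. by rewrite /entry mxE (inj_eq enum_rank_inj). Qed.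

Lemma diagopE (T : finType) (f : T -> C) :
  diagop f = opmx (fun s t => f s *+ (s == t)).
Proof. by apply/matrixP => i j; rewrite !mxE (inj_eq enum_val_inj). Qed.

Lemma mul_opmx (S T U : finType) (K : S -> T -> C) (L : T -> U -> C) :
  opmx K *m opmx L = opmx (fun s u => \sum_t K s t * L t u).
Proof.
apply/matrixP => i j; rewrite !mxE (reindex _ (onW_bij _ (@enum_rank_bij T))) /=.
by apply: eq_bigr => t _; rewrite !mxE enum_rankK.
Qed.

Lemma mul_diagop_opmx (S T : finType) (f : S -> C) (K : S -> T -> C) :
  diagop f *m opmx K = opmx (fun s t => f s * K s t).
Proof. by apply/matrixP => i j; rewrite mul_diag_mx !mxE. Qed.

Lemma mul_opmx_diagop (S T : finType) (K : S -> T -> C) (f : T -> C) :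
  opmx K *m diagop f = opmx (fun s t => K s t * f t).
Proof. by apply/matrixP => i j; rewrite mul_mx_diag !mxE. Qed.

Lemma mul_diagop (T : finType) (f g : T -> C) :
  diagop f *m diagop g = diagop (fun t => f t * g t).
Proof.
rewrite [diagop g]diagopE mul_diagop_opmx diagopE.
by apply: eq_opmx => s t; rewrite mulrnAr.
Qed.

Lemma adj_diagop (T : finType) (f : T -> C) :
  (diagop f)^t* = diagop (fun t => (f t)^*).
Proof.
apply/matrixP => i j; rewrite !mxE eq_sym.
by case: eqP => [->|_]; rewrite ?mulr1n ?mulr0n ?conjC0.
Qed.

Lemma scale_diagop (T : finType) a (f : T -> C) :
  a *: diagop f = diagop (fun t => a * f t).
Proof. by apply/matrixP => i j; rewrite !mxE mulrnAr. Qed.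

Lemma transport_diagop (S T : finType) (h : S -> T) (f : T -> C) :
  injective h -> transport h (diagop f) = diagop (f \o h).
Proof.
move=> inj_h; rewrite [RHS]diagopE /transport; apply: eq_opmx => s t.
by rewrite entry_diagop (inj_eq inj_h).
Qed.

Lemma tensop_diagop1 (F : finFieldType) k r (f : 'rV[F]_k -> C) :
  tensop (diagop f) (1%:M : op C 'rV[F]_r) = diagop (fun u => f (lsubmx u)).
Proof.
rewrite [RHS]diagopE /tensop; apply: eq_opmx => u v; rewrite entry_diagop entry1.
have -> : (u == v) = (lsubmx u == lsubmx v) && (rsubmx u == rsubmx v).
  apply/eqP/andP => [-> //|[/eqP el /eqP er]].
  by rewrite -[u]hsubmxK el er hsubmxK.
by rewrite mulrnAl mulr_natr -mulrnA mulnb andbC.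
Qed.

Lemma tensop_pow_diagop (F : finFieldType) n (f : F -> C) :
  tensop_pow n (diagop f) = diagop (fun x : 'rV[F]_n => \prod_(j < n) f (x 0 j)).
Proof.
rewrite [RHS]diagopE /tensop_pow; apply: eq_opmx => x y.
case: eqP => [->|/eqP/eqP neq_xy].
  by apply: eq_bigr => j _; rewrite entry_diagop eqxx.
have [j neq_j] : exists j, x 0 j != y 0 j.
  apply/existsP; rewrite -negb_forall; apply/negP => /forallP eq_xy.
  by apply: neq_xy; apply/rowP => j; apply/eqP.
by rewrite (bigD1 j) //= entry_diagop (negPf neq_j) mul0r.
Qed.

Definition relabelop (T : finType) (f : T -> T) : op C T :=
  opmx (fun s t : T => (s == f t)%:R).

Lemma mul_relabelop (T : finType) (f g : T -> T) :
  relabelop f *m relabelop g = relabelop (f \o g).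
Proof.
rewrite /relabelop mul_opmx; apply: eq_opmx => s t.
by rewrite (bigD1 (g t)) //= eqxx mulr1 big1 ?addr0 // => u /negPf->; rewrite mulr0.
Qed.

(** The operator of an involution is its own inverse, so this is a conjugation: [t] goes to [f t],
    picks up the phase there, and returns to [t]. *)
Lemma conj_relabelop (T : finType) (f : T -> T) (d : T -> C) : involutive f ->
  relabelop f *m diagop d *m relabelop f = diagop (d \o f).
Proof.
move=> fK; rewrite /relabelop mul_opmx_diagop mul_opmx diagopE; apply: eq_opmx => s t /=.
rewrite (bigD1 (f t)) //= eqxx mulr1 fK big1 => [|u /negPf->]; last by rewrite mulr0.
by rewrite addr0 mulr_natl; case: eqP => [->|].
Qed.

(** Column [u] of the encoder has its only nonzero entry at [u *m G], so a phase depending on the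
    codeword can be applied before encoding, as a phase depending on [u]. *)
Lemma mul_diagop_encoder (F : finFieldType) m n (G : 'M[F]_(m, n))
    (f : 'rV[F]_n -> C) :
  diagop f *m encoder C G = encoder C G *m diagop (fun u => f (u *m G)).
Proof.
rewrite /encoder mul_diagop_opmx mul_opmx_diagop; apply: eq_opmx => x u.
by rewrite mulrC; case: eqP => [->|]; rewrite ?mul0r.
Qed.

End Operators.

(** * The three-qubit gates: phases of W and conjugation by bit flips *)

Section Gates.

Variable C : numClosedFieldType.

Let false3 : bits := [ffun=> false].

Lemma bits_eq0E (b : bits) : (b == false3) = [&& ~~ b q1, ~~ b q2 & ~~ b q3].
Proof.
apply/eqP/and3P => [->|[b1 b2 b3]]; first by rewrite !ffunE.
apply/ffunP => -[[|[|[|//]]] lt_j]; rewrite ffunE; apply/negbTE.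
- by rewrite (_ : Ordinal _ = q1) //; apply: val_inj.
- by rewrite (_ : Ordinal _ = q2) //; apply: val_inj.
- by rewrite (_ : Ordinal _ = q3) //; apply: val_inj.
Qed.

Lemma mulCi_conj : 'i * ('i)^* = 1 :> C.
Proof. by rewrite conjCi mulrN -expr2 sqrCi opprK. Qed.

Lemma gateW_diagop : gateW C = diagop (fun b : bits => 'i ^+ (b != false3)).
Proof.
rewrite /gateW !adj_diagop !mul_diagop; apply: eq_diagop => b.
rewrite bits_eq0E; have ii := mulCi_conj.
(* In each of the eight cases every conjugate phase coming from a CS dagger cancels one factor ['i]
   by [ii]. *)
case: (b q1); case: (b q2); case: (b q3);
  by rewrite /= !(expr0, expr1, conjC1); ring: ii.
Qed.

Definition flip3 (b : bits) : bits := [ffun j => ~~ b j].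

Lemma flip3K : involutive flip3.
Proof. by move=> b; apply/ffunP => j; rewrite !ffunE negbK. Qed.

Lemma gateXXX_relabelop : gateXXX C = relabelop C flip3.
Proof.
have gateXE j : gateX C j = relabelop C (fun b : bits => [ffun l => b l (+) (l == j)]).
  by [].
rewrite /gateXXX !gateXE !mul_relabelop /relabelop; apply: eq_opmx => b b' /=.
congr (_ == _)%:R; apply/ffunP.
(* Each of the three positions is negated by exactly one of the three X gates. *)
by move=> [[|[|[|//]]] lt_j]; rewrite !ffunE /= ?addbF ?addFb ?addbT.
Qed.

(** The flips move the phase of the adjoint of CCS, the conjugate of ['i], from 111 to 000. The
    global factor ['i] cancels it there and appears on the other seven labels, as in
    [gateW_diagop]. *)
Lemma gateW_eq_XXX_adjCCS_XXX :
  gateW C = 'i *: (gateXXX C *m (gateCCS C)^t* *m gateXXX C).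
Proof.
rewrite gateXXX_relabelop adj_diagop (conj_relabelop _ flip3K) scale_diagop.
rewrite gateW_diagop; apply: eq_diagop => b; rewrite bits_eq0E /= !ffunE.
case: (b q1); case: (b q2); case: (b q3);
  by rewrite /= ?expr0 ?expr1 ?conjC1 ?mulr1 ?mulCi_conj.
Qed.

End Gates.

(** * The logical row as an enumeration of the field, and the rank of G *)

Section Distillation.

Variables (F : finFieldType) (alpha : F).
Hypotheses (cardF : #|F| = 8%N) (alpha3 : alpha ^+ 3 = alpha + 1).

Lemma alpha_neq0 : alpha != 0.
Proof.
apply: contra_eqN alpha3 => /eqP->.
by rewrite expr0n add0r eq_sym oner_eq0.
Qed.

(** The order divides the prime 7 because the Frobenius identity gives alpha^8 = alpha. It is not 1,
    since alpha = 1 would turn [alpha3] into 1 = 1 + 1. *)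
Lemma alpha_prim7 : 7.-primitive_root alpha.
Proof.
have alpha7 : alpha ^+ 7 = 1.
  by apply: (mulfI alpha_neq0); rewrite -exprS -cardF expf_card mulr1.
have [m prim_m] := prim_order_exists (isT : (0 < 7)%N) alpha7.
case/primeP: (isT : prime 7) => _ /[apply] /pred2P[m1|<- //].
have:= prim_expr_order prim_m; rewrite m1 expr1 => alpha1; exfalso.
move: alpha3; rewrite alpha1 expr1n => /eqP.
by rewrite -subr_eq0 opprD addrA subrr sub0r oppr_eq0 oner_eq0.
Qed.

Definition logical_symbol (i : 'I_8) : F := usubmx (distillG alpha) 0 i.

Lemma logical_symbolE i : logical_symbol i = if i == 0 then 0 else alpha ^+ i.
Proof.
rewrite /logical_symbol col_mxKu mxE.
case: i => [[|[|[|[|[|[|[|[|//]]]]]]]] lt_i] //=.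
(* Only the last entry remains: its literal 1 is alpha^7. *)
by rewrite (prim_expr_order alpha_prim7).
Qed.

(** Zero differs from all powers of alpha, and the exponents 1 to 7 are distinct modulo the order 7;
    equal cardinalities do the rest. *)
Lemma logical_symbol_bij : bijective logical_symbol.
Proof.
apply: inj_card_bij; last by rewrite cardF card_ord.
move=> i j; rewrite !logical_symbolE; have a0 k := expf_neq0 k alpha_neq0.
case: eqP => [->|/eqP i0]; case: eqP => [->|/eqP j0] //.
- by move/eqP; rewrite eq_sym (negPf (a0 _)).
- by move/eqP; rewrite (negPf (a0 _)).
move/eqP; rewrite (eq_prim_root_expr alpha_prim7) => eq_ij; apply: val_inj.
case: i j i0 j0 eq_ij => [[|i] lt_i] [[|j] lt_j] //= _ _.
(* The exponents lie in 1..7, so 1 is subtracted to reach 0..6, where reduction modulo 7 is the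
   identity. *)
by rewrite -(addn1 i) -(addn1 j) eqn_modDr !modn_small // => /eqP->.
Qed.

Lemma mul_distillG (u : 'rV[F]_(1 + 1)) i :
  (u *m distillG alpha) 0 i = lsubmx u 0 0 * logical_symbol i + rsubmx u 0 0.
Proof.
rewrite -[u in LHS]hsubmxK -[distillG alpha]vsubmxK mul_row_col.
rewrite mxE [X in X + _]mxE [X in _ + X]mxE !big_ord1.
by rewrite col_mxKd [const_mx _ _ _]mxE mulr1.
Qed.

(** Two columns suffice: the one with symbol 0 kills the stabilizer coefficient, then the one with
    symbol alpha kills the logical coefficient. *)
Lemma row_free_distillG : row_free (distillG alpha).
Proof.
apply: inj_row_free => u uG0.
have eq0 i : lsubmx u 0 0 * logical_symbol i + rsubmx u 0 0 = 0.
  by rewrite -mul_distillG uG0 mxE.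
have r0 : rsubmx u 0 0 = 0 by have:= eq0 0; rewrite logical_symbolE mulr0 add0r.
have /eqP := eq0 1; rewrite logical_symbolE r0 addr0 mulf_eq0 (negPf alpha_neq0) orbF.
move=> /eqP l0; rewrite -[u]hsubmxK -[0]hsubmxK !linear0.
by congr row_mx; apply/rowP => j; rewrite ord1 ?l0 ?r0 mxE.
Qed.

(** * The Z-distance *)

Lemma Zlogical_distillG (z : 'rV[F]_8) :
  Zlogical (distillG alpha) z <->
  \sum_i z 0 i = 0 /\ \sum_i logical_symbol i * z 0 i != 0.
Proof.
have stabE s : dotr (row s (dsubmx (distillG alpha))) z = \sum_i z 0 i.
  by apply: eq_bigr => i _; rewrite col_mxKd !mxE mul1r.
have logE l : dotr (row l (usubmx (distillG alpha))) z
    = \sum_i logical_symbol i * z 0 i.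
  by apply: eq_bigr => i _; rewrite ord1 mxE.
split=> [[/(_ 0) + [l]]|[z0 z1]]; first by rewrite stabE logE.
by split=> [s|]; [rewrite stabE | exists 0; rewrite logE].
Qed.

Lemma Zdistance_distillG : has_Zdistance (distillG alpha) 2.
Proof.
split=> [|z /Zlogical_distillG[sum_z dot_z]].
  (* Columns 0 and 1 carry the symbols 0 and alpha, so this vector sums to 0 but pairs to - alpha
     with the logical row. *)
  pose z : 'rV[F]_8 := delta_mx 0 0 - delta_mx 0 1.
  have zE i : z 0 i = (i == 0)%:R - (i == 1)%:R by rewrite !mxE.
  have sumz (a : 'I_8 -> F) : \sum_i a i * z 0 i = a 0 - a 1.
    rewrite (bigD1 0) // (bigD1 1) //= big1 => [|i /andP[/negPf i0 /negPf i1]].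
      by rewrite !zE /= subr0 sub0r mulr1 mulrN1 addr0.
    by rewrite zE i0 i1 subrr mulr0.
  exists z.
    apply/Zlogical_distillG; split.
      by have:= sumz (fun=> 1); rewrite subrr; under eq_bigr do rewrite mul1r.
    by rewrite sumz !logical_symbolE /= sub0r oppr_eq0 alpha_neq0.
  rewrite /hweight (_ : [set _ | _] = [set 0; 1]) ?cards2 //.
  apply/setP => i; rewrite !inE zE.
  case: (altP (i =P 0)) => [->|_]; first by rewrite subr0 oner_eq0.
  by rewrite sub0r oppr_eq0; case: (i == 1); rewrite ?oner_eq0 ?eqxx.
rewrite ltnNge; apply/negP => /card_le1_eqP le1.
case/negP: dot_z; apply/eqP/big1 => i _.
suff -> : z 0 i = 0 by rewrite mulr0.
(* With at most one nonzero entry, the coordinate sum equals that entry, so a zero sum forces the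
   vector to vanish. *)
apply/eqP; apply: contraPT sum_z => zi; rewrite (bigD1 i) //= big1 ?addr0; first exact/eqP.
move=> j; apply: contraNeq => zj; apply/eqP.
by apply: le1; rewrite inE.
Qed.

(** * The phase exponent over the field and the resulting diagonal operators *)

Lemma sum_cprod : (\sum_gamma Defs.cprod alpha gamma = 1)%N.
Proof.
have bij_of_bits : bijective (of_bits alpha).
  by exists (to_bits alpha); [apply: of_bitsK | apply: to_bitsK].
rewrite (reindex _ (onW_bij _ bij_of_bits)) /=.
under eq_bigr do rewrite /Defs.cprod of_bitsK //.
(* The sum over bit triples of the product of the bits factors into three sums over one bit, each 0
   + 1. *)
rewrite -(bigA_distr_bigA (fun _ (c : bool) => nat_of_bool c)) /= big1 // => j _.
by rewrite big_bool.
Qed.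

Lemma to_bits_inj : injective (to_bits alpha).
Proof. exact: can_inj (to_bitsK cardF alpha3). Qed.

Lemma to_bits_eq0 gamma : (to_bits alpha gamma == [ffun=> false]) = (gamma == 0).
Proof.
have of_bits0 : of_bits alpha [ffun=> false] = 0.
  by apply: big1 => j _; rewrite ffunE mul0r.
by rewrite -of_bits0 (can2_eq (to_bitsK cardF alpha3) (of_bitsK cardF alpha3)).
Qed.

Variable C : numClosedFieldType.

Lemma induced_phase_distillG (u : 'rV[F]_(1 + 1)) :
  'i ^+ (\sum_(i < 8) Defs.cprod alpha ((u *m distillG alpha)%R 0%R i))%N
    = 'i ^+ (lsubmx u 0 0 != 0) :> C.
Proof.
under eq_bigr do rewrite mul_distillG.
case: eqP => [->|/eqP x0] /=.
  under eq_bigr do rewrite mul0r add0r.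
  have i4 : 'i ^+ 4 = 1 :> C by rewrite (exprM _ 2 2) sqrCi sqrrN expr1n.
  by rewrite sum_nat_const card_ord (exprM _ 8) (exprM _ 4 2) i4 !expr1n.
have bij_symbol : bijective
    (fun i => lsubmx u 0 0 * logical_symbol i + rsubmx u 0 0).
  apply: inj_card_bij; last by rewrite cardF card_ord.
  by move=> i j /addIr/(mulfI x0)/(bij_inj logical_symbol_bij).
by have := sum_cprod; rewrite (reindex _ (onW_bij _ bij_symbol)) /= => ->.
Qed.

Lemma qudit_op1_gateW :
  qudit_op1 alpha (gateW C) = diagop (fun v : 'rV[F]_1 => 'i ^+ (v 0 0 != 0)).
Proof.
rewrite /qudit_op1 gateW_diagop transport_diagop.
  by apply: eq_diagop => v /=; rewrite to_bits_eq0.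
by move=> v w /to_bits_inj eq_vw; apply/rowP => j; rewrite ord1.
Qed.

Lemma induced_op_distillG :
  induced_op C alpha (distillG alpha)
    = tensop (qudit_op1 alpha (gateW C)) (1%:M : op C 'rV[F]_1).
Proof.
rewrite qudit_op1_gateW tensop_diagop1.
by apply: eq_diagop => u; rewrite induced_phase_distillG.
Qed.

(** Each qudit contributes ['i] to the power [cprod] of its symbol, and multiplying the phases adds
    the exponents. *)
Lemma transversal_CCS_diagop n :
  tensop_pow n (qudit_op alpha (gateCCS C))
    = diagop (fun x : 'rV[F]_n => 'i ^+ (\sum_(i < n) Defs.cprod alpha (x 0%R i))%N).
Proof.
rewrite /qudit_op (transport_diagop _ to_bits_inj) tensop_pow_diagop.
apply: eq_diagop => x; rewrite -prodrXr; apply: eq_bigr => i _ /=.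
congr ('i ^+ _); rewrite /Defs.cprod !big_ord_recl big_ord0 muln1 mulnA.
by congr (_ * _ * _)%N; congr (nat_of_bool (_ _)); apply: val_inj.
Qed.

End Distillation.

(** Confirms, for an arbitrary [G], that [induced_op] is the action of the physical CCS gates pulled
    back through the encoding. *)
Lemma transversal_CCS_encoder (C : numClosedFieldType) (F : finFieldType)
    (alpha : F) m n (G : 'M[F]_(m, n)) :
  #|F| = 8%N -> alpha ^+ 3 = alpha + 1 ->
  tensop_pow n (qudit_op alpha (gateCCS C)) *m encoder C G
    = encoder C G *m induced_op C alpha G.
Proof.
by move=> cardF alpha3; rewrite transversal_CCS_diagop // mul_diagop_encoder.
Qed.

Theorem mainTheorem18 (C : numClosedFieldType) (F : finFieldType) (alpha : F)
    (cardF : #|F| = 8%N) (alpha3 : alpha ^+ 3 = alpha + 1) :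
  let G : 'M[F]_(1 + 1, 8) := distillG alpha in
  let W : op C 'rV[F]_1 := qudit_op1 alpha (gateW C) in
  [/\ row_free G,
      has_Zdistance G 2,
      induced_op C alpha G = tensop W (1%:M : op C 'rV[F]_1),
      tensop_pow 8 (qudit_op alpha (gateCCS C)) *m encoder C G
        = encoder C G *m tensop W (1%:M : op C 'rV[F]_1)
    & exists2 w : C, `|w| = 1 &
        gateW C = w *: (gateXXX C *m (gateCCS C)^t* *m gateXXX C)].
Proof.
move=> G W; have inducedE := induced_op_distillG cardF alpha3 C.
split=> //.
- exact: row_free_distillG.
- exact: Zdistance_distillG.
- by rewrite -inducedE transversal_CCS_encoder.
- by exists 'i; [exact: normCi | exact: gateW_eq_XXX_adjCCS_XXX].
Qed.
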